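(* The average-case distortion of the Deferred Acceptance algorithm is at most $2$. That is, if $\mathcal{A}$ is the Deferred Acceptance algorithm (in its men-proposing version, or symmetrically its women-proposing version), then $$\mathrm{avdist}(\mathcal{A})=\sup_{n,F}\frac{\mathbb{E}_{\mathbf{v}\sim F}\left[\max_{\mu\in\mathcal{M}_s(\succ_{\mathbf{v}})}\mathrm{SW}(\mu\mid\mathbf{v})\right]}{\mathbb{E}_{\mathbf{v}\sim F}\left[\mathrm{SW}(\mathcal{A}(\succ_{\mathbf{v}})\mid\mathbf{v})\right]}\le 2 .$$
   Context: Setting (stable matching): there are two disjoint sets of agents, men $M$ and women $W$, with $|M|=|W|=n$. Every agent $a$ has a valuation function $v_a$ assigning a non-negative real value to each agent of the opposite side; $\mathbf{v}$ denotes the profile of all valuation functions. $\succ_{\mathbf{v}}$ denotes the preference profile induced by $\mathbf{v}$: each agent $a$ has a strict ranking $\succ_a$ of the opposite side by decreasing value, with ties broken by an arbitrary tie-breaking rule. A matching $\mu$ is a perfect one-to-one matching of $M$ and $W$; $\mu(a)$ is the partner of $a$. A pair $(m,w)$ is blocking for $\mu$ if $w\succ_m\mu(m)$ and $m\succ_w\mu(w)$; $\mu$ is stable if it has no blocking pair. $\mathcal{M}_s(\succ)$ is the set of stable matchings of $\succ$. The social welfare is $\mathrm{SW}(\mu\mid\mathbf{v})=\sum_{a\in M\cup W}v_a(\mu(a))$. The Deferred Acceptance (Gale–Shapley) algorithm takes only the preference profile $\succ$ as input. In its men-proposing version, while some man is not engaged and has not proposed to every woman, such a man proposes to the woman he ranks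 highest among those he has not yet proposed to; she becomes engaged to him if she is not engaged or prefers him to her current fiancé (who then becomes unengaged), and rejects him otherwise; the final engagements are the output. The output is the man-optimal stable matching, in which every man has the partner he ranks highest among all partners he has in stable matchings. The women-proposing version is the same with roles exchanged and outputs the woman-optimal stable matching. For a probability distribution $F$, $\mathbf{v}\sim F$ means that all the values $v_a(b)$, for all ordered pairs $(a,b)$ of agents of opposite sides, are drawn independently from $F$. The supremum is over all $n$ and all distributions $F$ (of non-negative values).
   Formalization: Ties are broken by one arbitrary (measurable) rule, possibly depending on the agent and the valuations, used in the same way for men and women; if the two sides may break ties by unrelated rules, the claim is false (the ratio is unbounded for Bernoulli values with small p). *)

(* Defs.v *)
From HB Require Import structures.
From mathcomp Require Import all_boot all_order all_algebra all_fingroup.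
From mathcomp Require Import all_classical all_reals all_analysis.

Set Implicit Arguments.
Unset Strict Implicit.
Unset Printing Implicit Defensive.

Import Order.TTheory GRing.Theory Num.Theory.

Local Open Scope classical_set_scope.
Local Open Scope ring_scope.

(* The men and the women are both indexed by 'I_n.  Strict rankings, one for
   each agent of one side: [P a b] is the position of [b] in the list of [a],
   position 0 being the best. *)
Definition prefs (n : nat) := {ffun 'I_n -> {perm 'I_n}}.

Definition prefers n (P : prefs n) (a b c : 'I_n) : bool := (P a b < P a c)%N.

(* Rankings of the men, then rankings of the women. *)
Definition profile (n : nat) := (prefs n * prefs n)%type.

(* Man [m] is matched with woman [mu m], woman [w] with man [(mu^-1)%g w]. *)
Definition matching (n : nat) := {perm 'I_n}.

Definition blocking n (P : profile n) (mu : matching n) (m w : 'I_n) : bool :=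
  prefers P.1 m w (mu m) && prefers P.2 w m ((mu^-1)%g w).

Definition stable n (P : profile n) (mu : matching n) : bool :=
  [forall m, forall w, ~~ blocking P mu m w].

Section DeferredAcceptance.
Variable n : nat.

Record DA_state := DAState {
  fiance : 'I_n -> option 'I_n;  (* of each woman *)
  proposed : {set 'I_n * 'I_n}   (* the pairs (m, w) where m proposed to w *)
}.

Definition DA_init := DAState (fun=> None) finset.set0.

Definition engaged (s : DA_state) (m : 'I_n) : bool :=
  [exists w, fiance s w == Some m].

Definition active (s : DA_state) (m : 'I_n) : bool :=
  ~~ engaged s m && [exists w, (m, w) \notin proposed s].

Definition next_choice (P : profile n) (s : DA_state) (m w : 'I_n) : bool :=
  ((m, w) \notin proposed s) &&
  [forall w', ((m, w') \notin proposed s) ==> (w' != w) ==>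
     prefers P.1 m w w'].

Definition accepts (P : profile n) (s : DA_state) (m w : 'I_n) : bool :=
  if fiance s w is Some m' then prefers P.2 w m m' else true.

Definition propose (P : profile n) (s : DA_state) (m w : 'I_n) : DA_state :=
  DAState (if accepts P s m w
           then fun w' => if w' == w then Some m else fiance s w'
           else fiance s)
          ((m, w) |: proposed s).

(* The algorithm does not fix the order in which active men propose. *)
Inductive DA_reachable (P : profile n) : DA_state -> Prop :=
| DA_start : DA_reachable P DA_init
| DA_step s m w : DA_reachable P s -> active s m -> next_choice P s m w ->
    DA_reachable P (propose P s m w).

Definition DA_output (P : profile n) (mu : matching n) : Prop :=
  exists s, [/\ DA_reachable P s, forall m, ~~ active s m &
    forall w, fiance s w = Some ((mu^-1)%g w)].

End DeferredAcceptance.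

Definition men_proposing_DA (A : forall n, profile n -> matching n) : Prop :=
  forall n (P : profile n), DA_output P (A n P).

Definition women_proposing_DA (A : forall n, profile n -> matching n) : Prop :=
  forall n (P : profile n), DA_output (P.2, P.1) (A n P)^-1%g.

Section DA_exists.
Variables (n : nat) (P : profile n).

Let inv (s : DA_state n) :=
  [/\ forall w w' m, fiance s w = Some m -> fiance s w' = Some m -> w = w' &
      forall m w, (m, w) \in proposed s -> fiance s w != None].

Let reachable_inv s : DA_reachable P s -> inv s.
Proof.
elim=> [|{}s m w _ [I1 I2] /andP[/existsPn nE _] _]; first by split=> // m w; rewrite inE.
have nEm w' : fiance s w' <> Some m by move=> e; have := nE w'; rewrite e eqxx.
split=> [w1 w2 m1|m1 w1] /=.
- case: ifP => _; last exact: I1.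
  case: eqP => [->|_]; case: eqP => [->|_] //.
  - by move=> [<-] /nEm.
  - by move=> /[swap] -[<-] /nEm.
  - exact: I1.
- rewrite finset.in_setU finset.in_set1 => /orP[/eqP[_ ->]|/I2 h].
  + by rewrite /accepts; case E : (fiance s w) => [m'|]; rewrite ?eqxx //; case: ifP; rewrite ?eqxx ?E.
  + by case: ifP => _ //; case: (w1 =P w).
Qed.

Let next_choice_ex s m : active s m -> exists w, next_choice P s m w.
Proof.
move=> /andP[_ /existsP[w0 w0P]].
case: (@arg_minnP _ w0 (fun w => (m, w) \notin proposed s) (fun w => P.1 m w) w0P).
move=> w wP wmin; exists w; rewrite /next_choice wP /=.
apply/forallP => w'; apply/implyP => w'P; apply/implyP => w'w.
rewrite /prefers ltn_neqAle wmin // andbT.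
by apply: contra w'w => /eqP/val_inj/perm_inj ->.
Qed.

(* Some run of the algorithm terminates and outputs a perfect matching, so
   that the predicates [men_proposing_DA] and [women_proposing_DA] are
   satisfiable. *)
Lemma DA_output_exists : exists mu, DA_output P mu.
Proof.
have [s sR sT] : exists2 s, DA_reachable P s & forall m, ~~ active s m.
  pose left (s : DA_state n) := #|~: proposed s|.
  suff H k s : (left s <= k)%N -> DA_reachable P s ->
      exists2 s, DA_reachable P s & forall m, ~~ active s m.
    exact: (H _ _ (leqnn _) (DA_start P)).
  elim: k s => [|k IH] s sk sR.
    exists s => // m; apply/negP => /andP[_ /existsP[w wP]].
    by move: sk; rewrite leqn0 finset.cards_eq0 => /eqP/setP/(_ (m, w)); rewrite !inE wP.
  have [/existsP[m mA]|/existsPn] := boolP [exists m, active s m]; last by exists s.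
  have [w wN] := next_choice_ex mA.
  apply: (IH (propose P s m w)); last exact: DA_step.
  rewrite -ltnS (leq_trans _ sk)// /left /= proper_card//.
  rewrite properE !finset.setCS finset.subsetUr /=.
  by rewrite finset.subUset finset.sub1set; case/andP: wN => /negbTE ->.
have [I1 I2] := reachable_inv sR.
have engS m : engaged s m.
  apply: contraT => nE.
  have allw w : fiance s w != None.
    have := sT m; rewrite /active nE /= => /existsPn/(_ w)/negPn; exact: I2.
  pose f w := odflt m (fiance s w).
  have fE w : fiance s w = Some (f w) by rewrite /f; case: fiance (allw w).
  have f_inj : injective f by move=> w w' e; apply: (I1 w w' (f w)); rewrite fE // e.
  have [g _ fK] := injF_bij f_inj.
  by move: nE => /existsPn/(_ (g m)); rewrite fE fK eqxx.
have engP m : exists w, fiance s w == Some m by apply/existsP/engS.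
pose h m := xchoose (engP m).
have hE m : fiance s (h m) = Some m by apply/eqP/(xchooseP (engP m)).
have h_inj : injective h by move=> m m' e; have := hE m; rewrite e hE => -[].
exists (perm h_inj), s; split=> // w.
by rewrite -[in LHS](permKV (perm h_inj) w) [in LHS]permE hE.
Qed.

End DA_exists.

Section Iid.
Context d (T : measurableType d) (R : realType).

Definition tcons k (x : T * k.-tuple T) : k.+1.-tuple T :=
  [tuple of x.1 :: x.2].

Lemma measurable_tcons k : measurable_fun setT (@tcons k).
Proof.
exact: (measurable_cons measurable_fst measurable_snd).
Qed.

HB.instance Definition _ k :=
  isMeasurableFun.Build _ _ _ _ (@tcons k) (@measurable_tcons k).

(* Law of k independent draws from Q, i.e. the k-fold product of Q. *)
Fixpoint iid (Q : probability T R) (k : nat) : probability (k.-tuple T) R :=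
  if k is k'.+1 then distribution (Q \x iid Q k')%E (@tcons k')
  else dirac [tuple].

End Iid.

Section Valuations.
Variable R : realType.

(* Valuations of the agents of one side: [value u a b] is the value that agent
   [a] assigns to agent [b] of the other side. *)
Definition valuations (n : nat) := n.-tuple (n.-tuple (measurableTypeR R)).

Definition value n (u : valuations n) (a b : 'I_n) : R := tnth (tnth u a) b.

(* Valuations of the men, then valuations of the women. *)
Definition valuation_profile (n : nat) := (valuations n * valuations n)%type.

Definition valuation_law (F : probability (measurableTypeR R) R) (n : nat)
    : probability (valuations n * valuations n)%type R :=
  (iid (iid F n) n \x iid (iid F n) n)%E.

Definition SW n (mu : matching n) (v : valuation_profile n) : R :=
  \sum_(m < n) value v.1 m (mu m) + \sum_(w < n) value v.2 w ((mu^-1)%g w).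

(* [ranking t u u'] are the rankings of the agents of one side, when [u] are
   the valuations of that side and [u'] those of the opposite side; the choice
   among the rankings compatible with [u] is arbitrary, up to measurability.
   The same rule serves both sides: if men and women could break ties by
   unrelated rules, the distortion would be unbounded (for distributions whose
   mass is concentrated at 0, ties make the stable matchings depend almost
   only on the rules). *)
Record tie_breaking (n : nat) := TieBreaking {
  ranking : valuations n -> valuations n -> prefs n;
  ranking_decreasing : forall u u' a b c,
    value u a c < value u a b -> prefers (ranking u u') a b c;
  ranking_measurable : forall P : prefs n,
    measurable [set v : valuation_profile n | ranking v.1 v.2 = P]
}.

Definition induced n (t : tie_breaking n) (v : valuation_profile n) : profile n :=
  (ranking t v.1 v.2, ranking t v.2 v.1).

Local Open Scope ereal_scope.

Definition max_stable_SW n (P : profile n) (v : valuation_profile n) : \bar R :=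
  \big[maxe/-oo]_(mu : matching n | stable P mu) (SW mu v)%:E.

Definition expected_max_stable_SW (F : probability (measurableTypeR R) R)
    n (t : tie_breaking n) : \bar R :=
  \int[valuation_law F n]_v max_stable_SW (induced t v) v.

Definition expected_SW (F : probability (measurableTypeR R) R)
    n (t : tie_breaking n) (A : profile n -> matching n) : \bar R :=
  \int[valuation_law F n]_v (SW (A (induced t v)) v)%:E.

(* With the conventions of [\bar R] the undefined ratios 0 / 0 and +oo / +oo
   are 0, and x / 0 = +oo for x > 0. *)
Definition avdist (t : forall n, tie_breaking n)
    (A : forall n, profile n -> matching n) : \bar R :=
  ereal_sup [set q | exists n (F : probability (measurableTypeR R) R),
    F `[0%R, +oo[%classic = 1 /\
    q = expected_max_stable_SW F (t n) / expected_SW F (t n) (A n)].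

End Valuations.

(* Main.v *)
(** In the man-optimal stable matching every man is as well off as in any stable
    matching, and symmetrically for the women; so the welfare of any stable
    matching is at most the men's welfare in the man-optimal matching plus the
    women's welfare in the woman-optimal one. Exchanging the two sides preserves
    the law of the valuations, so both terms have the same expectation, which is
    at most the expected welfare of Deferred Acceptance. *)

Require Import Defs.
From mathcomp Require Import all_boot all_order all_algebra all_fingroup.
From mathcomp Require Import all_classical all_reals all_analysis.
From mathcomp Require Import unstable measurable_realfun.

Set Implicit Arguments.
Unset Strict Implicit.
Unset Printing Implicit Defensive.

Import Order.TTheory GRing.Theory Num.Theory.

Local Open Scope classical_set_scope.
Local Open Scope ring_scope.

(** * Optimality of Deferred Acceptance for the proposing side *)

Section DeferredAcceptance.
Variables (n : nat) (P : profile n).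

(* The third and fourth clauses: men go down their lists, and a woman who
   dismisses a man is not his partner in any stable matching. *)
Record DA_invariant (s : DA_state n) : Prop := DAInvariant {
  fiance_inj : forall w w' m,
    fiance s w = Some m -> fiance s w' = Some m -> w = w';
  fiance_proposed : forall w m, fiance s w = Some m -> (m, w) \in proposed s;
  proposed_prefers : forall m w w', (m, w) \in proposed s ->
    prefers P.1 m w' w -> (m, w') \in proposed s;
  proposed_unstable : forall (mu : matching n) m, stable P mu ->
    (m, mu m) \in proposed s -> fiance s (mu m) = Some m
}.

Lemma prefers_total (Q : prefs n) (a b c : 'I_n) :
  b != c -> ~~ prefers Q a b c -> prefers Q a c b.
Proof.
move=> bc; rewrite /prefers -leqNgt leq_eqVlt => /orP[|//].
by move=> /eqP/val_inj/perm_inj cb; rewrite cb eqxx in bc.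
Qed.

(* If [l] were matched with [w] in a stable [mu], then [x] would prefer [w] to
   [mu x] or would have been dismissed by [mu x] before. *)
Lemma rejection_unstable (s : DA_state n) (w x l : 'I_n) (mu : matching n) :
  DA_invariant s -> prefers P.2 w x l ->
  (forall w', prefers P.1 x w' w -> (x, w') \in proposed s) ->
  (forall w', w' != w -> fiance s w' <> Some x) ->
  stable P mu -> mu l <> w.
Proof.
move=> I xl xw xE st mulw.
have mux : mu x != w.
  apply/eqP; rewrite -mulw => /perm_inj xl'.
  by move: xl; rewrite /prefers xl' ltnn.
have /forallP/(_ x)/forallP/(_ w) := st.
rewrite /blocking -[in X in _ && X]mulw permK mulw xl andbT => xN.
apply: (xE _ mux); apply: proposed_unstable => //; apply: xw.
by apply: prefers_total xN; rewrite eq_sym.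
Qed.

(** The substantial clause is the last one. When [w] has to choose between [m] and her fiancé [m'],
    [rejection_unstable] applies with the winner as [x] and the loser as [l]. *)
Lemma DA_reachable_invariant s : DA_reachable P s -> DA_invariant s.
Proof.
elim=> [|{}s m w _ I mA wN]; first by split=> // m w; rewrite !inE.
have {mA} nE w' : fiance s w' <> Some m.
  by case/andP: mA => /existsPn/(_ w')/eqP.
case/andP: wN => wP /forallP wbest.
have mtop w' : prefers P.1 m w' w -> (m, w') \in proposed s.
  move=> w'w; apply: contraT => w'P.
  have := wbest w'; rewrite w'P /=.
  have -> /= : w' != w by apply: contraTneq w'w => ->; rewrite /prefers ltnn.
  by rewrite /prefers ltnNge ltnW.
split=> [w1 w2 m1|w1 m1|m1 w1 w2|mu m1 st] /=.
- case: ifP => _; last exact: fiance_inj.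
  case: eqP => [->|_]; case: eqP => [->|_] //.
  + by move=> [<-] /nE.
  + by move=> /[swap] -[<-] /nE.
  + exact: fiance_inj.
- rewrite in_setU1; case: ifP => _; last first.
    by move=> /(fiance_proposed I) ->; rewrite orbT.
  case: eqP => [-> [->]|_ /(fiance_proposed I) ->]; rewrite ?eqxx//.
  by rewrite orbT.
- rewrite !in_setU1 => /orP[/eqP[-> ->] /mtop ->|]; first by rewrite orbT.
  by move=> /(proposed_prefers I)/[apply] ->; rewrite orbT.
- rewrite in_setU1 /accepts.
  case E : (fiance s w) => [m'|].
    have m'top w' : prefers P.1 m' w' w -> (m', w') \in proposed s.
      exact/(proposed_prefers I)/fiance_proposed.
    have m'E w' : w' != w -> fiance s w' <> Some m'.
      by move=> /eqP w'w /(fiance_inj I)/(_ E).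
    case: ifPn => acc.
      move=> /orP[/eqP[-> ->]|]; first by rewrite eqxx.
      move=> /(proposed_unstable I st) m1E; case: eqP => // mu1.
      move: m1E; rewrite mu1 E => -[m1E]; subst m1.
      by have := rejection_unstable I acc mtop (fun w' _ => nE w') st mu1.
    move=> /orP[/eqP[mm1 mu1]|/(proposed_unstable I st)//]; subst m1.
    have m'm : m != m' by apply: contra_notN (nE w) => /eqP ->.
    have := rejection_unstable I (prefers_total m'm acc) m'top m'E st.
    by move/(_ mu1).
  move=> /orP[/eqP[-> ->]|/(proposed_unstable I st)]; first by rewrite eqxx.
  by case: eqP => // ->; rewrite E.
Qed.

(** Had [m] preferred [mu m], he would have proposed to her before reaching [nu m]. By the last
    clause of the invariant she would still be engaged to him, and nobody has two fiancées. *)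
Lemma DA_output_optimal (nu mu : matching n) m :
  DA_output P nu -> stable P mu -> ~~ prefers P.1 m (mu m) (nu m).
Proof.
move=> [s [/DA_reachable_invariant I _ sE]] st; apply/negP => pref.
have nuE : fiance s (nu m) = Some m by rewrite sE permK.
have muP := proposed_prefers I (fiance_proposed I nuE) pref.
have := fiance_inj I (proposed_unstable I st muP) nuE.
by move=> e; move: pref; rewrite /prefers e ltnn.
Qed.

End DeferredAcceptance.

Lemma stable_swap n (P : profile n) (mu : matching n) :
  stable P mu -> stable (P.2, P.1) (mu^-1)%g.
Proof.
move=> /forallP st; apply/forallP => w; apply/forallP => m.
by have /forallP/(_ w) := st m; rewrite /blocking invgK andbC.
Qed.

(** * Integrals over a set of probability one *)

Section AlmostSure.
Context d (T : measurableType d) (R : realType) (mu : probability T R).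
Variables (D : set T) (mD : measurable D) (muD : mu D = 1%E).
Local Open Scope ereal_scope.

Lemma integral_full_measure (f : T -> \bar R) : measurable_fun setT f ->
  \int[mu]_x f x = \int[mu]_(x in D) f x.
Proof.
move=> mf.
have mDC : measurable (~` D) by exact: measurableC.
have muDC : mu (~` D) = 0 by rewrite probability_setC// muD subee.
rewrite integralE [RHS]integralE; congr (_ - _).
- rewrite (ge0_negligible_integral mDC)//; last exact: measurable_funepos.
  by rewrite setTD setCK.
- rewrite (ge0_negligible_integral mDC)//; last exact: measurable_funeneg.
  by rewrite setTD setCK.
Qed.

(** Dropping the negative part of [f] can only increase the integral, and [f^\+ <= g] because [g] is
    nonnegative. In the application [f] is a maximum that starts from [-oo]. *)
Lemma le_integral_nonneg (f g : T -> \bar R) :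
  measurable_fun D f -> measurable_fun D g ->
  (forall x, D x -> 0 <= g x) -> (forall x, D x -> f x <= g x) ->
  \int[mu]_(x in D) f x <= \int[mu]_(x in D) g x.
Proof.
move=> mf mg g0 fg; rewrite integralE.
apply: (@le_trans _ _ (\int[mu]_(x in D) f^\+ x)).
  by rewrite geeDl// oppe_le0; exact: integral_ge0.
apply: ge0_le_integral => //; first exact: measurable_funepos.
by move=> x Dx; rewrite funeposE ge_max fg// g0.
Qed.

End AlmostSure.

(** * Exchanging the two factors of the law *)

Section SymmetricLaw.
Context d (T : measurableType d) (R : realType) (mu : probability T R).
Local Open Scope ereal_scope.

(** By Tonelli, the two sides are the same iterated integral, since both factors carry the same
    law. *)
Lemma integral_swap (f : T * T -> \bar R) :
  measurable_fun setT f -> (forall x, 0 <= f x) ->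
  \int[mu \x mu]_x f (swap x) = \int[mu \x mu]_x f x.
Proof.
move=> mf f0.
have mfs : measurable_fun setT (f \o @swap T T).
  exact: (measurableT_comp mf (@measurable_swap _ _ T T)).
rewrite (fubini_tonelli1 (f \o @swap T T))//; last by move=> x; exact: f0.
by rewrite (fubini_tonelli2 f).
Qed.

Variables (N : set T) (mN : measurable N) (muN : mu N = 1).

Lemma integral_setX_swap (f : T * T -> \bar R) :
  measurable_fun setT f -> (forall x, (N `*` N) x -> 0 <= f x) ->
  \int[mu \x mu]_(x in N `*` N) f (swap x)
  = \int[mu \x mu]_(x in N `*` N) f x.
Proof.
move=> mf f0.
have mD : measurable (N `*` N) by exact: measurableX.
rewrite integral_mkcond [RHS]integral_mkcond.
rewrite -(integral_swap (f := f \_ (N `*` N))).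
- apply: eq_integral => -[x y] _; rewrite !patchE /=.
  by congr (if _ then _ else _); apply/idP/idP => /set_mem[? ?]; exact/mem_set.
- by apply/(measurable_restrictT _ mD)/measurable_funTS.
- by move=> x; apply: erestrict_ge0.
Qed.

(** Here [f] stands for the best stable welfare, [g] for the men's welfare in the man-optimal
    matching and [h] for the welfare of the algorithm. The disjunction covers its men-proposing and
    women-proposing versions. *)
Lemma integral_symmetric_le (f g h : T * T -> \bar R) :
  measurable_fun setT f -> measurable_fun setT g -> measurable_fun setT h ->
  (forall x, (N `*` N) x -> 0 <= g x) ->
  (forall x, (N `*` N) x -> f x <= g x + g (swap x)) ->
  (forall x, (N `*` N) x -> g x <= h x) \/
    (forall x, (N `*` N) x -> g (swap x) <= h x) ->
  \int[mu \x mu]_x f x <= 2%:E * \int[mu \x mu]_x h x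
  /\ 0 <= \int[mu \x mu]_x h x.
Proof.
move=> mf mg mh g0 fg gh.
have mD : measurable (N `*` N) by exact: measurableX.
have D1 : (mu \x mu) (N `*` N) = 1.
  by rewrite (_ : 1 = mu N * mu N) ?product_measure1E// muN mul1e.
have Dswap x : (N `*` N) x -> (N `*` N) (swap x) by case: x => x y [].
have mgs : measurable_fun setT (g \o @swap T T).
  exact: (measurableT_comp mg (@measurable_swap _ _ T T)).
rewrite (integral_full_measure mD D1 mf) (integral_full_measure mD D1 mh).
have gsh : \int[mu \x mu]_(x in N `*` N) g x
           <= \int[mu \x mu]_(x in N `*` N) h x.
  case: gh => gh; last rewrite -integral_setX_swap//.
  - by apply: ge0_le_integral => //; exact: measurable_funTS.
  - apply: ge0_le_integral => //.
    + by move=> x /Dswap; exact: g0.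
    + exact: (measurable_funTS mgs).
    + exact: measurable_funTS.
have gi0 : 0 <= \int[mu \x mu]_(x in N `*` N) g x by exact: integral_ge0.
split; last exact: le_trans gsh.
apply: (@le_trans _ _ (\int[mu \x mu]_(x in N `*` N) (g x + g (swap x)))).
  apply: le_integral_nonneg => //.
  - exact: measurable_funTS.
  - apply: emeasurable_funD; first exact: measurable_funTS.
    exact: (measurable_funTS mgs).
  - by move=> x Dx; rewrite adde_ge0 ?g0//; exact: Dswap.
rewrite ge0_integralD//; last 3 first.
- exact: measurable_funTS.
- by move=> x Dx; apply/g0/Dswap.
- exact: (measurable_funTS mgs).
by rewrite integral_setX_swap// -mule2n -mule_natl lee_pmul2l.
Qed.

End SymmetricLaw.

(** * Independent draws all lie in a set of full measure *)

Section Iid.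
Context d (T : measurableType d) (R : realType) (Q : probability T R).

Definition all_in k (N : set T) : set (k.-tuple T) :=
  [set x | forall i, N (tnth x i)].

Lemma measurable_all_in k N : measurable N -> measurable (@all_in k N).
Proof.
move=> mN.
rewrite (_ : all_in N = \bigcap_(i in [set: 'I_k]) ((tnth (T:=T))^~ i @^-1` N)).
  apply: fin_bigcap_measurable => // i _.
  by have := @measurable_tnth _ T k i measurableT N mN; rewrite setTI.
by apply/seteqP; split => [x xN i _|x xN i]; exact: xN.
Qed.

Lemma iid_all_in k N : measurable N -> Q N = 1%E ->
  iid Q k (@all_in k N) = 1%E.
Proof.
move=> mN QN; elim: k => [|k IH].
  by rewrite /= diracE mem_set// => -[].
rewrite /= /pushforward.
(* Pulled back along [tcons], the event is a rectangle: a condition on the head and one on the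
   tail. *)
rewrite (_ : _ @^-1` _ = N `*` @all_in k N).
  rewrite product_measure1E//; last exact: measurable_all_in.
  by transitivity (Q N * iid Q k (@all_in k N))%E => //; rewrite QN IH mule1.
apply/seteqP; split => -[x s] /=.
- move=> xsN; split=> [|i /=]; first by have := xsN ord0.
  by have := xsN (lift ord0 i); rewrite tnthS.
- by move=> [xN sN] i; case: (unliftP ord0 i) => [j|] ->; rewrite ?tnthS.
Qed.

End Iid.

(** * Social welfare, side by side *)

Section Welfare.
Variables (R : realType) (n : nat).
Implicit Types (u : valuations R n) (v : valuation_profile R n).

Definition side_welfare (mu : matching n) u : R :=
  \sum_(a < n) value u a (mu a).

(* [induced] alone denotes a charge of the analysis library. *)
Local Notation induced := Defs.induced.

Lemma SWE (mu : matching n) v :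
  SW mu v = side_welfare mu v.1 + side_welfare mu^-1%g v.2.
Proof. by []. Qed.

Lemma measurable_side_welfare mu : measurable_fun setT (side_welfare mu).
Proof.
rewrite /side_welfare; apply: measurable_sum => a; rewrite /value.
exact: (measurableT_comp (measurable_tnth (mu a)) (measurable_tnth a)).
Qed.

Lemma measurable_SW mu : measurable_fun setT (@SW R n mu).
Proof.
rewrite (_ : SW mu =
    (fun v => side_welfare mu v.1 + side_welfare mu^-1%g v.2)) //.
apply: measurable_funD.
- exact: (measurableT_comp (measurable_side_welfare mu) measurable_fst).
- exact: (measurableT_comp (measurable_side_welfare mu^-1%g) measurable_snd).
Qed.

Lemma measurable_max_stable_SW P :
  measurable_fun setT (@max_stable_SW R n P).
Proof.
rewrite /max_stable_SW; elim: (index_enum _) => [|mu s IH].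
  rewrite (_ : (fun _ => _) = cst -oo%E)//.
  by apply/funext => v; rewrite big_nil.
rewrite (_ : (fun v => _) = (fun v =>
    let m := \big[maxe/-oo%E]_(nu <- s | stable P nu) (SW nu v)%:E in
    if stable P mu then maxe (SW mu v)%:E m else m)); last first.
  by apply/funext => v; rewrite big_cons.
case: (stable P mu) => //=; apply: measurable_maxe => //.
by apply/measurable_EFinP; exact: measurable_SW.
Qed.

(** There are finitely many profiles, and on the measurable set where the induced profile is [P] the
    function agrees with [h P]. *)
Lemma measurable_induced (t : tie_breaking R n)
    (h : profile n -> valuation_profile R n -> \bar R) :
  (forall P, measurable_fun setT (h P)) ->
  measurable_fun setT (fun v => h (induced t v) v).
Proof.
move=> mh _ B mB; rewrite setTI.
rewrite (_ : _ @^-1` B =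
    \bigcup_(P in [set: {ffun 'I_n -> {perm 'I_n}} *
                        {ffun 'I_n -> {perm 'I_n}}])
      (([set v | ranking t v.1 v.2 = P.1] `&`
        @swap _ _ @^-1` [set v | ranking t v.1 v.2 = P.2]) `&` h P @^-1` B)).
  apply: fin_bigcup_measurable => [|P _]; first exact: finite_finset.
  apply: measurableI; first apply: measurableI.
  - exact: ranking_measurable.
  - rewrite -[X in measurable X]setTI.
    by apply: measurable_swap => //; exact: ranking_measurable.
  - by rewrite -[X in measurable X]setTI; exact: mh.
apply/seteqP; split => [v hB|v [[P1 P2] _ [[/= <- <-]]]//].
by exists (induced t v).
Qed.

Variable (t : tie_breaking R n).
Variable (B : profile n -> matching n).
Hypothesis BP : forall P, DA_output P (B P).

(** A strictly larger value forces a strict preference whatever the tie-breaking, which would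
    contradict [DA_output_optimal]. *)
Lemma value_optimal v (mu : matching n) a :
  stable (induced t v) mu ->
  value v.1 a (mu a) <= value v.1 a (B (induced t v) a).
Proof.
move=> st; rewrite leNgt; apply/negP => /ranking_decreasing pref.
by have /negP := DA_output_optimal a (BP (induced t v)) st; apply; exact: pref.
Qed.

(** Since one tie-breaking rule serves both sides, [induced t (swap v)] is the profile of [v] with
    the sides exchanged; [B] then lets the women propose. *)
Lemma stable_SW_le v (mu : matching n) : stable (induced t v) mu ->
  SW mu v <= side_welfare (B (induced t v)) v.1 +
             side_welfare (B (induced t (swap v))) v.2.
Proof.
move=> st; rewrite SWE lerD// ler_sum// => a _; first exact: value_optimal.
exact: (@value_optimal (swap v) _ _ (stable_swap st)).
Qed.

Lemma side_welfare_ge0 mu u :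
  all_in (all_in (`[0, +oo[ : set (measurableTypeR R))) u ->
  0 <= side_welfare mu u.
Proof.
move=> u0; apply: sumr_ge0 => a _.
by have := u0 a (mu a); rewrite /= in_itv/= andbT.
Qed.

Lemma expected_max_stable_SW_le (F : probability (measurableTypeR R) R)
    (A : profile n -> matching n) :
  F `[0%R, +oo[%classic = 1%E ->
  (forall P, A P = B P) \/ (forall P, (A (P.2, P.1))^-1%g = B P) ->
  (expected_max_stable_SW F t <= 2%:E * expected_SW F t A)%E
  /\ (0 <= expected_SW F t A)%E.
Proof.
move=> F0 AB.
have m0 : measurable (`[0%R, +oo[ : set (measurableTypeR R)).
  exact: measurable_itv.
have mN := measurable_all_in (k := n) (measurable_all_in (k := n) m0).
have N1 := iid_all_in n (measurable_all_in (k := n) m0) (iid_all_in n m0 F0).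
apply: (integral_symmetric_le mN N1
  (g := fun v => (side_welfare (B (induced t v)) v.1)%:E)) => //.
- exact: (measurable_induced t measurable_max_stable_SW).
- apply: (@measurable_induced t (fun P v => (side_welfare (B P) v.1)%:E)) => P.
  apply/measurable_EFinP.
  exact: (measurableT_comp (measurable_side_welfare (B P)) measurable_fst).
- apply: (@measurable_induced t (fun P v => (SW (A P) v)%:E)) => P.
  by apply/measurable_EFinP; exact: measurable_SW.
- by move=> v [v1 _]; rewrite lee_fin side_welfare_ge0.
- move=> v _; rewrite /max_stable_SW; apply: bigmax_le => [|mu st].
    exact: leNye.
  by rewrite -EFinD lee_fin; exact: stable_SW_le.
(* Men proposing: [g v] is the men's share of the welfare of [A]. Women proposing: [g (swap v)] is
   the women's share. The other share is nonnegative. *)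
- case: AB => AB; [left|right] => v [v1 v2]; rewrite lee_fin SWE.
  + by rewrite AB lerDl side_welfare_ge0.
  + by rewrite -AB lerDr side_welfare_ge0.
Qed.

End Welfare.

(** * From the two expectations to their ratio *)

Lemma lee_ratio2 (R : realType) (x y : \bar R) :
  (x <= 2%:E * y -> 0 <= y -> x / y <= 2%:E)%E.
Proof.
(* Degenerate denominators: [+oo] has inverse 0, so the ratio is 0; if [y] is 0 then [x <= 0], so
   multiplying by the inverse [+oo] gives at most 0. *)
move: y => [y| |]//; last by rewrite invey mule0 lee_fin.
move=> xy; rewrite lee_fin le_eqVlt => /predU1P[y0|y0].
  rewrite -y0 mule0 in xy; rewrite -y0 inve0.
  by rewrite (@le_trans _ _ 0%E) ?lee_fin// mule_le0_ge0.
by rewrite inver gt_eqF// lee_pdivrMr.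
Qed.

Theorem theorem5p1 (R : realType) (t : forall n : nat, tie_breaking R n)
    (A : forall n : nat, profile n -> matching n)
    (hA : men_proposing_DA A \/ women_proposing_DA A) :
  (avdist t A <= 2%:E)%E.
Proof.
apply: ge_ereal_sup => q [n [F [F0 ->]]].
(* [B] is men-proposing in either case: exchanging the sides of the input and inverting the output
   turns a women-proposing algorithm into a men-proposing one. *)
pose B (P : profile n) :=
  if pselect (men_proposing_DA A) then A n P else (A n (P.2, P.1))^-1%g.
have [//||xy y0] := @expected_max_stable_SW_le R n (t n) B _ F (A n) F0.
- move=> P; rewrite /B; case: pselect => // hM.
  case: hA => // /(_ n (P.2, P.1)).
  by case: P.
- by rewrite /B; case: pselect => ?; [left|right].
exact: lee_ratio2.
Qed.
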